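(* Let $(X,d)$ be a metric space and let $\mathcal{S}$ be a bornology on $X$. Then the following statements are equivalent: (i) $\mathcal{S}$ is a totally bounded family on $X$; (ii) $(CL(X),\mathcal{U}_{\mathcal{S},d})$ is metrizable (as a uniform space); (iii) $(CL(X),\tau_{\mathcal{S},d})$ is metrizable; (iv) $(CL(X),\tau_{\mathcal{S},d})$ is first countable.
   Context: For a metric space $(X,d)$, $\mathcal{P}_0(X)$ is the set of all nonempty subsets of $X$ and $CL(X)$ is the set of all nonempty closed subsets. A bornology on $X$ is a family $\mathcal{S}\subseteq\mathcal{P}_0(X)$ that is closed under finite unions and under taking (nonempty) subsets and covers $X$. For $x\in X$ and $A\in\mathcal{P}_0(X)$, $d(x,A)=\inf\{d(x,a):a\in A\}$, and $B_d(A,\epsilon)=\{x\in X:d(x,A)<\epsilon\}$. The uniformity $\mathcal{U}_{\mathcal{S},d}$ on $CL(X)$ has as a base the sets $[S,\epsilon]=\{(A,C)\in CL(X)\times CL(X): \sup_{x\in S}|d(x,A)-d(x,C)|<\epsilon\}$, $S\in\mathcal{S}$, $\epsilon>0$, and $\tau_{\mathcal{S},d}$ is the topology it induces on $CL(X)$. A nonempty family $\mathcal{S}\subseteq\mathcal{P}_0(X)$ is a totally bounded family on $X$ if there is a countable subcollection $\{S_n:n\in\mathbb{N}\}$ of $\mathcal{S}$ such that for each $S\in\mathcal{S}$ and $\epsilon>0$ we have $S\subseteq\bigcup_{n\in F}B_d(S_n,\epsilon)$ for some finite subset $F$ of $\mathbb{N}$. *)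

(* Defs.v *)
From HB Require Import structures.
From mathcomp Require Import all_boot all_order all_algebra.
From mathcomp Require Import all_classical all_reals all_analysis.

Set Implicit Arguments.
Unset Strict Implicit.
Unset Printing Implicit Defensive.

Import Order.TTheory GRing.Theory Num.Theory.

Local Open Scope classical_set_scope.
Local Open Scope ring_scope.

Record is_metric (R : realType) (T : Type) (rho : T -> T -> R) : Prop := {
  is_metric_ge0 : forall x y, 0 <= rho x y ;
  is_metric_eq0 : forall x y, rho x y = 0 <-> x = y ;
  is_metric_sym : forall x y, rho x y = rho y x ;
  is_metric_triangle : forall x y z, rho x z <= rho x y + rho y z }.

Definition uniformly_metrizable (R : realType) (T : uniformType) : Prop :=
  exists rho : T -> T -> R, is_metric rho /\
    @entourage T = filter_from [set e : R | 0 < e]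
                     (fun e => [set xy | rho xy.1 xy.2 < e]).

Definition metrizable (R : realType) (T : topologicalType) : Prop :=
  exists rho : T -> T -> R, is_metric rho /\
    forall x : T, nbhs x = filter_from [set e : R | 0 < e]
                             (fun e => [set y | rho x y < e]).

Definition first_countable (T : topologicalType) : Prop :=
  forall x : T, exists B : set_system T,
    [/\ countable B, B `<=` nbhs x &
        forall U, nbhs x U -> exists2 V, B V & V `<=` U].

Section metric_families.
Context {R : realType} {X : metricType R}.

(* As inf is the real-valued infimum, this is only meaningful for A nonempty. *)
Definition set_dist (x : X) (A : set X) : R := inf [set mdist x a | a in A].

Definition enlargement (A : set X) (e : R) : set X :=
  [set x | set_dist x A < e].

Definition totally_bounded_family (S : set (set X)) : Prop :=
  [/\ S !=set0, forall A, S A -> A !=set0 &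
      exists S_ : nat -> set X, (forall n, S (S_ n)) /\
        forall A (e : R), S A -> 0 < e ->
          exists2 F : set nat, finite_set F &
            A `<=` \bigcup_(n in F) enlargement (S_ n) e].

End metric_families.

(* bornology_neq0 follows from bornology_cover as soon as X is nonempty; it
   excludes the degenerate case of an empty X with its empty bornology. *)
Record bornology (R : realType) (X : metricType R) := Bornology {
  bornology_sets :> set (set X) ;
  bornology_neq0 : bornology_sets !=set0 ;
  bornology_mem_neq0 : forall A, bornology_sets A -> A !=set0 ;
  bornology_setU : forall A B,
    bornology_sets A -> bornology_sets B -> bornology_sets (A `|` B) ;
  bornology_sub : forall A B,
    bornology_sets A -> B !=set0 -> B `<=` A -> bornology_sets B ;
  bornology_cover : \bigcup_(A in bornology_sets) A = [set: X] }.

(* The bornology is a parameter of the type of nonempty closed sets so that the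
   uniform structure, and the topology it induces, can be inferred from it. *)
Definition CL (R : realType) (X : metricType R) (S : bornology X) : Type :=
  {A : set X | A !=set0 /\ closed A}.

HB.instance Definition _ (R : realType) (X : metricType R) (S : bornology X) :=
  gen_eqMixin (CL S).
HB.instance Definition _ (R : realType) (X : metricType R) (S : bornology X) :=
  gen_choiceMixin (CL S).

Section hyperspace_uniformity.
Context {R : realType} {X : metricType R} (S : bornology X).
Local Open Scope relation_scope.

(* The supremum is taken in the extended reals since S need not consist of
   bounded sets, so that it may be infinite. *)
Definition CL_base (A : set X) (e : R) : set (CL S * CL S) :=
  [set BC | (ereal_sup [set `|set_dist x (sval BC.1)
                              - set_dist x (sval BC.2)|%:E | x in A]
             < e%:E)%E].

Definition CL_entourage : set_system (CL S * CL S) :=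
  filter_from [set Ae : set X * R | bornology_sets S Ae.1 /\ 0 < Ae.2]
              (fun Ae => CL_base Ae.1 Ae.2).

Let CL_base_sub A B e e' : A `<=` B -> e <= e' ->
  CL_base B e `<=` CL_base A e'.
Proof.
move=> AB ee' BC /= h; apply: (@lt_le_trans _ _ e%:E); last by rewrite lee_fin.
by apply: le_lt_trans h; apply: ereal_sup_le; exact: image_subset.
Qed.

Let CL_entourage_filter : Filter CL_entourage.
Proof.
apply: filter_from_filter.
  by have [A SA] := bornology_neq0 S; exists (A, 1); split => /=.
move=> [A e] [B e'] [/= SA e0] [/= SB e'0].
exists (A `|` B, Num.min e e') => /=.
  by split; [exact: bornology_setU | rewrite lt_min e0].
by rewrite subsetI; split; apply: CL_base_sub => //;
  rewrite ge_min lexx ?orbT.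
Qed.

Let CL_entourage_diagonal E : CL_entourage E -> diagonal `<=` E.
Proof.
move=> [[A e] [/= SA e0] sE] [B C]; rewrite /diagonal /= => <-.
apply: sE; rewrite /CL_base /=.
apply: (@le_lt_trans _ _ 0%:E); last by rewrite lte_fin.
by apply: ge_ereal_sup => _ [x _ <-]; rewrite subrr normr0.
Qed.

Let CL_entourage_inv E : CL_entourage E -> CL_entourage E^-1.
Proof.
move=> [[A e] [/= SA e0] sE]; exists (A, e) => // -[B C] h; apply: sE.
apply: le_lt_trans h; apply: ereal_sup_le => _ [x Ax <-] /=.
by exists x => //; rewrite distrC.
Qed.

Let CL_entourage_split E :
  CL_entourage E -> exists2 F, CL_entourage F & F \; F `<=` E.
Proof.
move=> [[A e] [/= SA e0] sE]; exists (CL_base A (e / 2)).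
  by exists (A, e / 2) => //; split => //=; rewrite divr_gt0.
move=> [B D] [C /= hBC hCD]; apply: sE; rewrite /CL_base /=.
have -> : e%:E = ((e / 2)%:E + (e / 2)%:E)%E by rewrite -EFinD -splitr.
apply: le_lt_trans (lteD hBC hCD).
apply: ge_ereal_sup => _ [x Ax <-] /=.
apply: (@le_trans _ _ (`|set_dist x (sval B) - set_dist x (sval C)|%:E +
                       `|set_dist x (sval C) - set_dist x (sval D)|%:E)%E).
  by rewrite -EFinD lee_fin ler_distD.
by apply: leeD; apply: ereal_sup_ubound; exists x.
Qed.

HB.instance Definition _ := isUniform.Build (CL S)
  CL_entourage_filter CL_entourage_diagonal CL_entourage_inv
  CL_entourage_split.

End hyperspace_uniformity.

(* Main.v *)
Require Import Defs.
From mathcomp Require Import all_boot all_order all_algebra.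
From mathcomp Require Import all_classical all_reals all_analysis.
From mathcomp Require Import lra.

(** Why the equivalence holds.

    If countably many members [S_ n] of the bornology witness total
    boundedness, then uniform closeness of two distance functionals
    [d(., B)] and [d(., C)] on the sets [S_ n] already controls them on every
    member: distance functionals are 1-Lipschitz, and each member lies, up to
    any [e], in finitely many enlargements of the [S_ n].  The uniformity is
    thus given by countably many (possibly infinite-valued) pseudometrics, and
    capping the [n]-th of them at [1/(n+1)] before taking the supremum turns
    them into the single metric [capped_dist].  The cap makes the supremum
    finite, and also lets the indices beyond [N] contribute at most [1/(N+2)],
    so that a small ball constrains only finitely many [S_ n]
    ([entourage_capped_dist]).  Separation holds because a bornology contains
    the singletons while a nonempty closed set is the zero set of its distance functional
    ([CL_separated]).

    A uniform metric induces the topology, and metrizable spaces are first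
    countable, so it remains to return from first countability to total
    boundedness.  Take a countable local base at the point [X] of
    the hyperspace.  Each basic neighbourhood contains one of the
    form [[A, e](X)] with [A] in the bornology, and the countably many [A]
    obtained in this way are the required subfamily: the closure of [A] always
    belongs to [[A, e](X)], since both distance functionals vanish on [A], so
    if [[A, e](X)] is included in [[B, e'](X)] then [d(x, A) < e'] for all [x]
    in [B] ([first_countable_totally_bounded]). *)

Set Implicit Arguments.
Unset Strict Implicit.
Unset Printing Implicit Defensive.

Import Order.TTheory GRing.Theory Num.Theory.

Local Open Scope classical_set_scope.
Local Open Scope ring_scope.

(** * Distance to a set *)

Section set_dist_theory.
Context {R : realType} {X : metricType R}.
Implicit Types (x y : X) (A C : set X).

Lemma set_dist_has_lbound x A : has_lbound [set mdist x a | a in A].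
Proof. by exists 0 => _ [a _ <-]; exact: mdist_ge0. Qed.

Lemma set_dist_le x a A : A a -> set_dist x A <= mdist x a.
Proof. by move=> Aa; apply: ge_inf; [exact: set_dist_has_lbound|exists a]. Qed.

Lemma set_dist_ge0 x A : A !=set0 -> 0 <= set_dist x A.
Proof.
case=> a Aa; apply: lb_le_inf; first by exists (mdist x a), a.
by move=> _ [b _ <-]; exact: mdist_ge0.
Qed.

Lemma set_dist_ltP x A e : A !=set0 ->
  set_dist x A < e <-> exists2 a, A a & mdist x a < e.
Proof.
move=> [a0 Aa0]; split=> [|[a Aa]]; last exact/le_lt_trans/set_dist_le.
case/inf_lt; first by exists (mdist x a0), a0.
by move=> _ [a Aa <-]; exists a.
Qed.

Lemma set_dist_mem x A : A x -> set_dist x A = 0.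
Proof.
move=> Ax; apply/eqP; rewrite eq_le set_dist_ge0 ?andbT; last by exists x.
by rewrite -(mdistxx x) set_dist_le.
Qed.

Lemma set_dist_triangle x y A : A !=set0 ->
  set_dist x A <= mdist x y + set_dist y A.
Proof.
move=> A0; rewrite -lerBlDl; apply: lb_le_inf.
  by case: A0 => a Aa; exists (mdist y a), a.
move=> _ [a Aa <-]; rewrite lerBlDl.
by apply: le_trans (metric_triangle x y a); exact: set_dist_le.
Qed.

(** Both distance functionals are 1-Lipschitz, so their gap is 2-Lipschitz:
    this is what transfers estimates from a dense part to a whole set. *)
Lemma set_dist_diff_le x y A C : A !=set0 -> C !=set0 ->
  `|set_dist x A - set_dist x C| <=
    `|set_dist y A - set_dist y C| + mdist x y *+ 2.
Proof.
move=> A0 C0.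
have h1 := set_dist_triangle x y A0; have h2 := set_dist_triangle x y C0.
have h3 := set_dist_triangle y x A0; have h4 := set_dist_triangle y x C0.
rewrite (metric_sym y x) in h3 h4.
rewrite ler_norml mulr2n; have := ler_norm (set_dist y A - set_dist y C).
have := lerNnormlW (lexx `|set_dist y A - set_dist y C|).
by move=> *; apply/andP; split; lra.
Qed.

Lemma closure_set_distP x A : A !=set0 ->
  closure A x <-> forall e, 0 < e -> set_dist x A < e.
Proof.
move=> A0; split=> [clAx e e0|h U].
  have [|a [Aa]] := clAx [set y | mdist x y < e].
    by apply/metricType_numDomainType.nbhs_mdistP; exists e.
  by move=> xa; apply/set_dist_ltP => //; exists a.
move=> /metricType_numDomainType.nbhs_mdistP[e /= e0 eU].
have /(set_dist_ltP _ _ A0)[a Aa xa] := h e e0.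
by exists a; split => //; exact: eU.
Qed.

Lemma set_dist_closure x A : A !=set0 -> set_dist x (closure A) = set_dist x A.
Proof.
move=> A0; have clA0 : closure A !=set0.
  by case: A0 => a Aa; exists a; exact: subset_closure.
apply/eqP; rewrite eq_le; apply/andP; split.
  apply: lb_le_inf; first by case: A0 => a Aa; exists (mdist x a), a.
  by move=> _ [a Aa <-]; apply: set_dist_le; exact: subset_closure.
apply: lb_le_inf; first by case: clA0 => a Aa; exists (mdist x a), a.
move=> _ [c clAc <-]; apply/ler_addgt0Pr => e e0.
apply: le_trans (set_dist_triangle x c A0) _.
by rewrite lerD2l ltW//; move/(closure_set_distP _ A0): clAc; apply.
Qed.

End set_dist_theory.

(** * The uniformity of uniform convergence on members of the bornology *)

Section CL_theory.
Context {R : realType} {X : metricType R} {S : bornology X}.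
Implicit Types (A : set X) (B C : CL S).

Lemma CL_neq0 B : sval B !=set0. Proof. exact: (svalP B).1. Qed.

Lemma CL_closed B : closed (sval B). Proof. exact: (svalP B).2. Qed.

Lemma CL_base_lt A e B C x : CL_base A e (B, C) -> A x ->
  `|set_dist x (sval B) - set_dist x (sval C)| < e.
Proof.
move=> h Ax; rewrite -lte_fin; apply: le_lt_trans h.
by apply: ereal_sup_ubound; exists x.
Qed.

Lemma CL_base_le A r e B C : r < e ->
  (forall x, A x -> `|set_dist x (sval B) - set_dist x (sval C)| <= r) ->
  CL_base A e (B, C).
Proof.
move=> re h; apply: (@le_lt_trans _ _ r%:E); last by rewrite lte_fin.
by apply: ge_ereal_sup => _ [x Ax <-]; rewrite lee_fin; exact: h.
Qed.

Lemma entourage_CL_base A e : bornology_sets S A -> 0 < e ->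
  @entourage (CL S) (CL_base A e).
Proof. by move=> SA e0; exists (A, e). Qed.

Lemma bornology_set1 x : bornology_sets S [set x].
Proof.
have : [set: X] x by [].
rewrite -(bornology_cover S) => -[A SA Ax].
by apply: (bornology_sub SA) => [|_ ->//]; exists x.
Qed.

(** The uniformity is Hausdorff: singletons belong to the bornology, so the
    entourages determine all distances to a set, hence the set as it is
    closed. *)
Lemma CL_separated B C :
  (forall E, @entourage (CL S) E -> E (B, C)) -> B = C.
Proof.
move=> h; have dist_eq x : set_dist x (sval B) = set_dist x (sval C).
  apply/eqP; rewrite -subr_eq0 -normr_le0; apply/ler_addgt0Pr => e e0.
  rewrite add0r ltW//.
  exact: CL_base_lt (h _ (entourage_CL_base (bornology_set1 x) e0)) _.
have sub (D D' : CL S) :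
    (forall x, set_dist x (sval D) = set_dist x (sval D')) ->
    sval D `<=` sval D'.
  move=> DD' x Dx; suff: closure (sval D') x by exact: (@CL_closed D').
  apply/closure_set_distP => [|e e0]; first exact: CL_neq0.
  by rewrite -DD' set_dist_mem.
case: B C h dist_eq sub => [B pB] [C pC] _ dist_eq sub.
apply: eq_exist; apply/seteqP; split.
  exact: (sub (exist _ B pB) (exist _ C pC)).
by apply: (sub (exist _ C pC) (exist _ B pB)) => x; rewrite dist_eq.
Qed.

Lemma bornology_bigsetU (S_ : nat -> set X) N :
  (forall n, bornology_sets S (S_ n)) ->
  exists2 A, bornology_sets S A & forall n, (n <= N)%N -> S_ n `<=` A.
Proof.
move=> SS; elim: N => [|N [A SA hA]].
  by exists (S_ 0%N) => // n; rewrite leqn0 => /eqP ->.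
exists (A `|` S_ N.+1); first exact: bornology_setU.
move=> n; rewrite leq_eqVlt ltnS.
by move=> /orP[/eqP -> x|/hA nA x /nA]; [right|left].
Qed.

End CL_theory.

(** * A metric from a countable dense subfamily *)

Section capped_metric.
Context {R : realType} {X : metricType R} (S : bornology X).
Variable S_ : nat -> set X.
Hypothesis SS_ : forall n, bornology_sets S (S_ n).
Implicit Types (B C D : CL S).

(** The cap [1/(n+1)] tends to 0, which makes all but finitely many indices
    negligible in the supremum below. *)
Definition capped_gap n x B C : R :=
  Num.min n.+1%:R^-1 `|set_dist x (sval B) - set_dist x (sval C)|.

Definition capped_gaps B C : set R :=
  [set r | exists n x, S_ n x /\ r = capped_gap n x B C].

Definition capped_dist B C : R := sup (capped_gaps B C).

Lemma capped_gaps_neq0 B C : capped_gaps B C !=set0.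
Proof.
have [x Sx] := bornology_mem_neq0 (SS_ 0).
by exists (capped_gap 0 x B C), 0%N, x.
Qed.

Lemma capped_gap_le n x B C : S_ n x -> capped_gap n x B C <= capped_dist B C.
Proof.
move=> Snx; apply: ub_le_sup; last by exists n, x.
exists 1 => _ [m [y [_ ->]]]; rewrite /capped_gap ge_min.
by rewrite invf_le1 ?ltr0n// ler1n.
Qed.

Lemma capped_dist_le r B C :
  (forall n x, S_ n x -> capped_gap n x B C <= r) -> capped_dist B C <= r.
Proof.
move=> h; apply: ge_sup; first exact: capped_gaps_neq0.
by move=> _ [n [x [Snx ->]]]; exact: h.
Qed.

Lemma capped_gap_ge0 n x B C : 0 <= capped_gap n x B C.
Proof. by rewrite le_min invr_ge0 ler0n normr_ge0. Qed.

Lemma capped_dist_ge0 B C : 0 <= capped_dist B C.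
Proof.
have [x Sx] := bornology_mem_neq0 (SS_ 0).
exact: le_trans (capped_gap_ge0 0 x B C) (capped_gap_le _ _ Sx).
Qed.

Lemma capped_distxx B : capped_dist B B = 0.
Proof.
apply/eqP; rewrite eq_le capped_dist_ge0 andbT; apply: capped_dist_le => n x _.
by rewrite /capped_gap subrr normr0 ge_min lexx orbT.
Qed.

Lemma capped_distC B C : capped_dist B C = capped_dist C B.
Proof.
congr sup; apply/seteqP.
by split=> _ [n [x [Snx ->]]]; exists n, x; split=> //;
  rewrite /capped_gap distrC.
Qed.

Lemma capped_dist_triangle B C D :
  capped_dist B D <= capped_dist B C + capped_dist C D.
Proof.
apply: capped_dist_le => n x Snx.
apply: le_trans (lerD (capped_gap_le _ _ Snx) (capped_gap_le _ _ Snx)).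
rewrite /capped_gap.
have := ler_distD (set_dist x (sval C)) (set_dist x (sval B))
  (set_dist x (sval D)).
move: (normr_ge0 (set_dist x (sval B) - set_dist x (sval C))).
move: (normr_ge0 (set_dist x (sval C) - set_dist x (sval D))).
have : 0 <= n.+1%:R^-1 :> R by rewrite invr_ge0.
move: (n.+1%:R^-1) `|_ - _| `|_ - _| `|_ - _| => c r s t *.
by rewrite /Num.min; do !case: ifPn; rewrite -?leNgt => *; lra.
Qed.

Hypothesis S_dense : forall A (e : R), bornology_sets S A -> 0 < e ->
  exists2 F : set nat, finite_set F &
    A `<=` \bigcup_(n in F) enlargement (S_ n) e.

(** A small ball forces small gaps on the finitely many [S_ n] that approximate
    a given member of the bornology; conversely a single member containing the
    first [S_ n]'s controls [capped_dist], the caps taking care of the rest. *)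
Lemma entourage_capped_dist : @entourage (CL S) =
  filter_from [set e : R | 0 < e]
    (fun e => [set BC | capped_dist BC.1 BC.2 < e]).
Proof.
apply/seteqP; split=> [E [[A e] /= [SA e0] sE]|E [e /= e0 sE]].
  have e4 : 0 < e / 4 by rewrite divr_gt0.
  have [F finF AF] := S_dense SA e4.
  have [N FN] : exists N, forall n, F n -> (n <= N)%N.
    have /finite_fsetP[Y FY] := finF.
    exists (\max_(i <- finmap.enum_fset Y) i)%N => n.
    by rewrite FY /= => nY; exact: leq_bigmax_seq.
  (* A radius at most 1/(N+1) disables the caps of index at most N, and the
     quarter leaves room for the two Lipschitz errors below: 3e/4 < e. *)
  exists (Num.min (e / 4) N.+1%:R^-1).
    by rewrite /= lt_min e4 invr_gt0 ltr0Sn.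
  move=> [B C] /= BC; apply: sE; apply: (@CL_base_le _ _ _ _ (e / 4 * 3)).
    by lra.
  move=> x /AF[n Fn xSn].
  have /(set_dist_ltP _ _ (bornology_mem_neq0 (SS_ n)))[s Sns xs] := xSn.
  have gap : `|set_dist s (sval B) - set_dist s (sval C)| < e / 4.
    have := le_lt_trans (capped_gap_le B C Sns) BC.
    rewrite /capped_gap gt_min !lt_min => /orP[/andP[_]|/andP[]//].
    by rewrite ltf_pV2 ?posrE ?ltr0Sn// ltr_nat ltnS ltnNge FN.
  apply: le_trans (set_dist_diff_le x s (CL_neq0 B) (CL_neq0 C)) _.
  by rewrite mulr2n; lra.
have [N Ne] : exists N : nat, N.+1%:R^-1 < e / 2.
  have [|N] := @ltr_add_invr R 0 (e / 2); first by rewrite divr_gt0.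
  by rewrite add0r; exists N.
have [A SA SnA] := bornology_bigsetU N SS_.
exists (A, e / 2); first by split=> //=; rewrite divr_gt0.
move=> [B C] /= BC; apply: sE => /=.
apply: (@le_lt_trans _ _ (e / 2)); last by lra.
apply: capped_dist_le => n x Snx; rewrite /capped_gap ge_min.
have [nN|Nn] := leqP n N.
  by rewrite (ltW (CL_base_lt BC (SnA _ nN _ Snx))) orbT.
rewrite (le_trans _ (ltW Ne))// lef_pV2 ?posrE ?ltr0Sn// ler_nat ltnS.
exact: ltnW.
Qed.

Lemma capped_dist_is_metric : is_metric capped_dist.
Proof.
split; [exact: capped_dist_ge0| |exact: capped_distC|
        exact: capped_dist_triangle].
move=> B C; split=> [BC0|->]; last exact: capped_distxx.
apply: CL_separated => E; rewrite entourage_capped_dist => -[e /= e0]; apply.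
by rewrite /= BC0.
Qed.

End capped_metric.

Lemma totally_bounded_uniformly_metrizable (R : realType) (X : metricType R)
    (S : bornology X) :
  totally_bounded_family S -> uniformly_metrizable R (CL S).
Proof.
move=> [_ _ [S_ [SS_ S_dense]]]; exists (@capped_dist _ _ S S_); split.
  exact: capped_dist_is_metric.
exact: entourage_capped_dist.
Qed.

(** * Metrizability and first countability *)

Lemma uniformly_metrizable_metrizable (R : realType) (T : uniformType) :
  uniformly_metrizable R T -> metrizable R T.
Proof.
move=> [rho [rhoM entE]]; exists rho; split=> // x.
apply/seteqP; split=> U.
  move=> /nbhsP[E]; rewrite entE => -[e /= e0 eE] EU; exists e => // y xy.
  by apply: EU; rewrite /xsection/= inE; exact: eE.
move=> [e /= e0 eU]; apply/nbhsP; exists [set xy | rho xy.1 xy.2 < e].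
  by rewrite entE; exists e.
by move=> y; rewrite /xsection/= inE; exact: eU.
Qed.

Lemma metrizable_first_countable (R : realType) (T : topologicalType) :
  metrizable R T -> first_countable T.
Proof.
move=> [rho [_ nbhsE]] x.
exists (range (fun n : nat => [set y | rho x y < n.+1%:R^-1])); split.
- exact: card_image_le.
- move=> _ [n _ <-]; rewrite nbhsE.
  by exists n.+1%:R^-1 => //=; rewrite invr_gt0.
- move=> U; rewrite nbhsE => -[e /= e0 eU].
  have [n ne] := ltr_add_invr e0; rewrite add0r in ne.
  exists [set y | rho x y < n.+1%:R^-1]; first by exists n.
  by move=> y /= xy; apply: eU; exact: lt_trans xy ne.
Qed.

(** The local base is taken at the whole space: there, the neighbourhood
    attached to [A] says how well a closed set approximates [A], and it is
    tested on the closure of [A]. *)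
Lemma first_countable_totally_bounded (R : realType) (X : metricType R)
    (S : bornology X) :
  first_countable (CL S) -> totally_bounded_family S.
Proof.
move=> fcS; split; [exact: bornology_neq0|exact: bornology_mem_neq0|].
have X0 : [set: X] !=set0.
  have [A SA] := bornology_neq0 S.
  by have [a _] := bornology_mem_neq0 SA; exists a.
pose whole : CL S := exist _ [set: X] (conj X0 closedT).
have [W [cW Wnbhs Wbase]] := fcS whole.
(* Choosing on all V, with an arbitrary member of S outside the base W, keeps
   g total. *)
have /(choice (X := set (CL S)))[g gP] : forall V : set (CL S),
    exists A : set X, bornology_sets S A /\
      (W V -> exists2 e, 0 < e & forall C, CL_base A e (whole, C) -> V C).
  move=> V; have [WV|nWV] := pselect (W V); last first.
    by have [A SA] := bornology_neq0 S; exists A; split.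
  have /nbhsP[E [[A e] /= [SA e0] AeE] EV] := Wnbhs V WV.
  exists A; split=> // _; exists e => // C AeC.
  by apply: EV; rewrite /xsection/= inE; exact: AeE.
have /pfcard_geP[W0|[f]] := cW.
  by have [V] := Wbase setT filterT; rewrite W0.
exists (g \o f); split=> [n|A e SA e0]; first exact: (gP _).1.
have [V WV Vsub] : exists2 V, W V & V `<=` xsection (CL_base A e) whole.
  apply: Wbase; apply/nbhsP; exists (CL_base A e) => //.
  exact: entourage_CL_base.
have [n _ fn] : (f @` setT) V by exact: surj.
have [SgV /(_ WV)[e' e'0 gV]] := gP V.
have g0 := bornology_mem_neq0 SgV.
have clg0 : closure (g V) !=set0.
  by case: g0 => a ga; exists a; exact: subset_closure.
pose C : CL S := exist _ (closure (g V)) (conj clg0 (@closed_closure _ _)).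
exists [set n]; first exact: finite_set1.
move=> x Ax; exists n => //=; rewrite /enlargement/= fn.
have : V C.
  apply/gV/(CL_base_le e'0) => y gy /=.
  by rewrite !set_dist_mem ?subrr ?normr0//; exact: subset_closure.
move/Vsub; rewrite /xsection/= inE => /CL_base_lt/(_ Ax)/=.
rewrite (@set_dist_mem _ _ x setT)// sub0r normrN set_dist_closure//.
exact: ltr_normlW.
Qed.

Theorem theorem5p10 (R : realType) (X : metricType R) (S : bornology X) :
  [<-> totally_bounded_family S;
       uniformly_metrizable R (CL S);
       metrizable R (CL S);
       first_countable (CL S)].
Proof.
tfae.
- exact: totally_bounded_uniformly_metrizable.
- exact: uniformly_metrizable_metrizable.
- exact: metrizable_first_countable.
- exact: first_countable_totally_bounded.
Qed.
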